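(* Let $X$ be a finite weighted simplicial complex with positive weights, let $D=d_{\max}(X)\ge1$, let $f\colon\mathbb{R}\to\mathbb{R}$ be differentiable with $f(0)=0$ and $f'(0)>0$, let $0\le d\le D$ and $\omega_d\in C_d(X)$. If $x_d\in C_d(X)$ is a fixed point of the $d$-simplex flow on $X$, then the linearization of the flow around $x_d$ is the operator $L_{x_d}\colon\mathbb{R}^{|X_d|}\to\mathbb{R}^{|X_d|}$ given by $$L_{x_d}=-\left[W_d^{-1}B_{d+1}W_{d+1}\,\mathrm{diag}\big(f'(B_{d+1}^{\intercal}x_d)\big)B_{d+1}^{\intercal}+B_d^{\intercal}W_{d-1}^{-1}\,\mathrm{diag}\big(f'(B_dW_dx_d)\big)B_dW_d\right],$$ where for $d=0$ only the first term in the bracket is taken and for $d=D$ only the second term is taken.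
   Context: Let $X$ be a finite simplicial complex (a finite collection of nonempty finite sets, called simplices, closed under taking faces). $X_d$ is the set of simplices of dimension $d$ (with $d+1$ vertices), and $d_{\max}(X)$ is the maximal dimension of a simplex. Each simplex is given an orientation, and each simplex $F$ carries a weight $w(F)>0$. $C_d(X)$ is the real vector space with basis $X_d$, identified with $\mathbb{R}^{|X_d|}$ via this basis. $B_d$ is the matrix of the boundary map $\partial_d\colon C_d(X)\to C_{d-1}(X)$, $[v_0,\dots,v_d]\mapsto\sum_{\ell=0}^d(-1)^\ell[v_0,\dots,\widehat{v_\ell},\dots,v_d]$ ($d\ge1$), and $W_d$ is the diagonal matrix of the weights of the $d$-simplices. Scalar functions ($f$, $f'$) are applied to vectors componentwise; $\mathrm{diag}(v)$ is the square diagonal matrix with the components of $v$ on the diagonal. Given $f\colon\mathbb{R}\to\mathbb{R}$ and $\omega_d\in C_d(X)$, and with $D=d_{\max}(X)$, the $d$-simplex flow is the system $$\frac{d}{dt}\theta_d=\omega_d-\left[W_d^{-1}B_{d+1}W_{d+1}f(B_{d+1}^{\intercal}\theta_d)+B_d^{\intercal}W_{d-1}^{-1}f(B_dW_d\theta_d)\right],\qquad \theta_d\in C_d(X),$$ where for $d=0$ the second term in the bracket is dropped and for $d=D$ the first term in the bracket is dropped. A fixed point is a vector at which the right-hand side vanishes. The linearization at a fixed point $x_d$ is the derivative (Jacobian) at $x_d$ of the right-hand side as a map $\mathbb{R}^{|X_d|}\to\mathbb{R}^{|X_d|}$. *)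

(* Defs.v *)
From HB Require Import structures.
From mathcomp Require Import all_boot all_order all_algebra all_fingroup.
From mathcomp Require Import reals.

Set Implicit Arguments.
Unset Strict Implicit.
Unset Printing Implicit Defensive.

Import Order.TTheory GRing.Theory Num.Theory.

Local Open Scope ring_scope.

Record scomplex (V : finType) := SComplex {
  simplices :> {set {set V}};
  simplices_neq0 : set0 \notin simplices;
  simplices_face : forall F G : {set V},
    F \in simplices -> G \subset F -> G != set0 -> G \in simplices
}.

(* An orientation is an ordering of the vertices up to even permutations; it is
   given here by a chosen ordering of the vertices of each simplex. *)
Record orientation (V : finType) (X : scomplex V) := Orientation {
  vertex_seq :> {set V} -> seq V;
  vertex_seqP : forall F : {set V}, F \in X -> perm_eq (vertex_seq F) (enum F)
}.

Section SimplexFlow.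
Variables (R : realType) (V : finType) (X : scomplex V).

Definition simplices_dim (d : nat) : {set {set V}} :=
  [set F in X | #|F| == d.+1].

Definition dmax : nat := \max_(F in X) #|F|.-1.

(* Parity of the permutation of the common vertex set taking [t] to [s]; only
   meaningful when [s] and [t] are duplicate-free with the same elements. *)
Definition odd_reordering (s t : seq V) : bool :=
  [exists u : {perm V},
    [&& perm_on [set x in t] u, map u t == s & odd_perm u]].

Definition weight_mx (w : {set V} -> R) (d : nat) :
    'M[R]_#|simplices_dim d| :=
  diag_mx (\row_i w (enum_val i)).

Variable o : orientation X.

(* The chain of the oriented simplex [[s_0, ..., s_d]]: plus or minus the basis
   vector of its underlying simplex, according to the chosen orientation. *)
Definition oriented_simplex (d : nat) (s : seq V) : 'cV[R]_#|simplices_dim d| :=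
  \col_i (if [set x in s] == enum_val i
          then (-1) ^+ odd_reordering s (o (enum_val i)) else 0).

Definition omit (l : nat) (s : seq V) : seq V := take l s ++ drop l.+1 s.

(* Only used for [d >= 1]; [d.-1] has no meaning at [d = 0]. *)
Definition boundary_mx (d : nat) :
    'M[R]_(#|simplices_dim d.-1|, #|simplices_dim d|) :=
  \matrix_(i, j)
    (\sum_(l < d.+1)
       (-1) ^+ l *: oriented_simplex d.-1 (omit l (o (enum_val j)))) i 0.

Definition simplex_flow (w : {set V} -> R) (f : R -> R) (d : nat)
    (omega theta : 'cV[R]_#|simplices_dim d|) : 'cV[R]_#|simplices_dim d| :=
  omega -
  ((if (d < dmax)%N then
      invmx (weight_mx w d) *m boundary_mx d.+1 *m weight_mx w d.+1
        *m map_mx f ((boundary_mx d.+1)^T *m theta)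
    else 0)
   + (if (0 < d)%N then
        (boundary_mx d)^T *m invmx (weight_mx w d.-1)
          *m map_mx f (boundary_mx d *m weight_mx w d *m theta)
      else 0)).

End SimplexFlow.

Arguments simplices_dim {V} X d.
Arguments boundary_mx R {V X} o d.
Arguments weight_mx {R V} X w d.

(* Main.v *)
Require Import Defs.
From HB Require Import structures.
From mathcomp Require Import all_boot all_order all_algebra all_fingroup.
From mathcomp Require Import boolp classical_sets functions reals topology normedtype derive.

Set Implicit Arguments.
Unset Strict Implicit.
Unset Printing Implicit Defensive.

Import Order.TTheory GRing.Theory Num.Theory.
Import numFieldNormedType.Exports.

Local Open Scope ring_scope.

Section Differentials.
Variable R : realType.

Lemma is_diff_sum (V W : normedModType R) (I : Type) (r : seq I)
    (F dF : I -> V -> W) (x : V) :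
    (forall i, is_diff x (F i) (dF i)) ->
  is_diff x (\sum_(i <- r) F i) (\sum_(i <- r) dF i).
Proof.
move=> dFx; elim: r => [|i r IHr]; first by rewrite !big_nil; exact: is_diff_cst.
by rewrite !big_cons; exact: is_diffD.
Qed.

(** A matrix-valued map is a finite sum of its entries times the constant matrices
    [delta_mx i j]. *)
Lemma is_diff_mx (V : normedModType R) (m n : nat) (F dF : V -> 'M[R]_(m, n))
    (x : V) :
    (forall i j, is_diff x (fun v => F v i j) (fun v => dF v i j)) ->
  is_diff x F dF.
Proof.
have mxE_sum (G : V -> 'M[R]_(m, n)) :
    G = \sum_(i < m) \sum_(j < n) (fun v => G v i j *: delta_mx i j).
  apply/funext => v; rewrite {1}[G v]matrix_sum_delta fct_sumE.
  by apply: eq_bigr => i _; rewrite fct_sumE.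
move=> dFx; rewrite [F]mxE_sum [dF]mxE_sum.
apply: is_diff_sum => i; apply: is_diff_sum => j.
exact: (is_diff_comp (dFx i j) (is_diff_scalel _ _)).
Qed.

Lemma is_diff_coord (m n : nat) (M : 'M[R]_(m, n)) i j :
  is_diff M (fun N : 'M[R]_(m, n) => N i j) (fun N => N i j).
Proof.
have coord_linear : linear (fun N : 'M[R]_(m, n) => N i j : R^o).
  by move=> a A B; rewrite !mxE.
(* Packing the coordinate as a linear map lets [diff_lin] apply: a continuous linear map is its own
   differential. *)
pose mixin := GRing.isLinear.Build _ _ _ _ _ coord_linear.
pose g : {linear 'M[R]_(m, n) -> R^o} :=
  HB.pack (fun N : 'M[R]_(m, n) => N i j : R^o) mixin.
by apply: DiffDef; [exact: differentiable_coord|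
  exact: (diff_lin M (@coord_continuous _ _ _ i j : continuous g))].
Qed.

Lemma is_diff_mulmxl (p m n : nat) (A : 'M[R]_(p, m)) (M : 'M[R]_(m, n)) :
  is_diff M (mulmx A) (mulmx A).
Proof.
apply: is_diff_mx => i j.
have -> : (fun N : 'M[R]_(m, n) => (A *m N) i j) =
    \sum_(k < m) (A i k *: (fun N : 'M[R]_(m, n) => N k j)).
  by apply/funext => N; rewrite mxE fct_sumE.
by apply: is_diff_sum => k; apply: is_diffZ; exact: is_diff_coord.
Qed.

Lemma is_diff_derive1 (f : R -> R) (a : R) :
  derivable f a 1 -> is_diff a f ( *:%R^~ (derive1 f a)).
Proof.
by move=> /derivable1_diffP df; apply: DiffDef => //; rewrite diff1E.
Qed.

(** Entry [i] of the image depends only on entry [i] of the argument, so the Jacobian is diagonal.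
    The transpose is there because [diag_mx] expects a row. *)
Lemma is_diff_map_cV (n : nat) (f : R -> R) (y : 'cV[R]_n) :
    (forall i, derivable f (y i 0) 1) ->
  is_diff y (map_mx f) (mulmx (diag_mx (map_mx (derive1 f) y)^T)).
Proof.
move=> df; apply: is_diff_mx => i j; rewrite ord1.
have -> : (fun v : 'cV[R]_n => (map_mx f v) i 0) = f \o (fun v => v i 0).
  by apply/funext => v; rewrite mxE.
apply: is_diff_eq.
  exact: (is_diff_comp (is_diff_coord y i 0) (is_diff_derive1 (df i))).
by apply/funext => v; rewrite mul_diag_mx !mxE /= mulrC.
Qed.

Lemma is_diff_mulmx_map_cV (p m n : nat) (A : 'M[R]_(p, m)) (C : 'M[R]_(m, n))
    (f : R -> R) (x : 'cV[R]_n) :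
    (forall a, derivable f a 1) ->
  is_diff x (fun v => A *m map_mx f (C *m v))
    (mulmx (A *m diag_mx (map_mx (derive1 f) (C *m x))^T *m C)).
Proof.
move=> df; have dC := is_diff_mulmxl C x.
have dfC := is_diff_comp dC (is_diff_map_cV (fun i => df ((C *m x) i 0))).
apply: is_diff_eq; first exact: (is_diff_comp dfC (is_diff_mulmxl A _)).
by apply/funext => v; rewrite /= !mulmxA.
Qed.

End Differentials.

Theorem theorem3p3 (R : realType) (V : finType) (X : scomplex V)
    (o : orientation X) (w : {set V} -> R)
    (w_gt0 : forall F : {set V}, F \in X -> 0 < w F)
    (dmax_ge1 : (1 <= dmax X)%N)
    (f : R -> R) (f_derivable : forall a : R, derivable f a 1)
    (f0 : f 0 = 0) (df0_gt0 : 0 < derive1 f 0)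
    (d : nat) (d_le : (d <= dmax X)%N)
    (omega x : 'cV[R]_#|simplices_dim X d|)
    (x_fixed : simplex_flow o w f omega x = 0) :
  let W := weight_mx X w in
  let B := boundary_mx R o in
  let L : 'M[R]_#|simplices_dim X d| :=
    - ((if (d < dmax X)%N then
          invmx (W d) *m B d.+1 *m W d.+1
            *m diag_mx (map_mx (derive1 f) ((B d.+1)^T *m x))^T *m (B d.+1)^T
        else 0)
       + (if (0 < d)%N then
            (B d)^T *m invmx (W d.-1)
              *m diag_mx (map_mx (derive1 f) (B d *m W d *m x))^T *m B d *m W d
          else 0)) in
  is_diff x (simplex_flow o w f omega) (fun v => L *m v).
Proof.
(* Keeping the test [b] inside the statement treats the cases [d = 0] and [d = dmax X] uniformly: a
   dropped term is the zero map, with zero differential. *)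
have diff_if (b : bool) (p : nat) (A : 'M[R]_(#|simplices_dim X d|, p))
    (C : 'M[R]_(p, #|simplices_dim X d|)) :
    is_diff x (fun v => if b then A *m map_mx f (C *m v) else 0)
      (mulmx (if b then A *m diag_mx (map_mx (derive1 f) (C *m x))^T *m C
              else 0)).
  case: b => /=; first exact: is_diff_mulmx_map_cV.
  by apply: is_diff_eq; apply/funext => v; rewrite mul0mx.
move=> W B L.
have dup := diff_if (d < dmax X)%N _
  (invmx (W d) *m B d.+1 *m W d.+1) (B d.+1)^T.
have ddown := diff_if (0 < d)%N _ ((B d)^T *m invmx (W d.-1)) (B d *m W d).
apply: (is_diff_eq (is_diffB (is_diff_cst omega x) (is_diffD dup ddown))).
(* The constant [omega] contributes zero; only regrouping of matrix products remains. *)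
apply/funext => v; by rewrite /L mulNmx mulmxDl [LHS]sub0r !mulmxA.
Qed.
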